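(* Let $(\Omega,\mathcal F,\mathbb P)$ be a probability space. For each $N\in\mathbb N$ let $\{t_j\}_{j\in\mathbb N}=\{t_j^{(N)}\}_{j\in\mathbb N}$ be a sequence of positive random variables on this space (the dependence on $N$ is suppressed in the notation) satisfying: (i) $\mathbb E(t_i)=\frac1N$ for all $i$ and all $N$; (ii) there exist $r>0$ and a constant $\tilde C>0$ such that $\mathbb E(t_i^{2+r})\le \frac{\tilde C}{N^{2+r}}$ for all $i$ and all $N$; (iii) for all $m\in\mathbb N$ (and all $N$), the vector $(t_1,\dots,t_m)$ is negatively superadditive dependent. Set $\tau_0=0$ and $\tau_i=\sum_{j=1}^i t_j$ for $i\ge1$. Let $W=(W_s)_{s\ge0}$ be a random function on the same probability space that is almost surely continuous, let $a\in\mathbb R$, and consider observations $$Y_{\tau_i}=a\tau_i+W_{\tau_i}-W_{\tau_{i-1}},\qquad i=1,\dots,N,$$ with estimator $$\hat a_{N}=\frac{\sum_{i=1}^{N}Y_{\tau_i}\tau_i}{\sum_{i=1}^{N}\tau_i^2}.$$ Then, almost surely as $N\to\infty$, $$N\big(\hat a_{N}-a\big)\to 3\int_0^1 (W_1-W_s)\,ds.$$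
   Context: A function $\phi:\mathbb R^m\to\mathbb R$ is superadditive if $\phi(x\vee y)+\phi(x\wedge y)\ge\phi(x)+\phi(y)$ for all $x,y\in\mathbb R^m$, where $\vee$ and $\wedge$ denote componentwise maximum and minimum. A random vector $(X_1,\dots,X_m)$ is negatively superadditive dependent (NSD) if for every superadditive $\phi$ such that the expectation $\mathbb E\phi(X_1,\dots,X_m)$ exists, $\mathbb E\phi(X_1,\dots,X_m)\le\mathbb E\phi(X_1^*,\dots,X_m^* )$, where $X_1^*,\dots,X_m^*$ are independent and $X_i^*$ has the same distribution as $X_i$ for each $i$. *)

(* Defs.v *)
From HB Require Import structures.
From mathcomp Require Import all_boot all_order all_algebra.
From mathcomp Require Import all_classical all_reals all_analysis.
Set Implicit Arguments. Unset Strict Implicit. Unset Printing Implicit Defensive.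
Import Order.TTheory GRing.Theory Num.Theory.
Import numFieldNormedType.Exports.
Local Open Scope classical_set_scope.
Local Open Scope ring_scope.

(* Componentwise maximum / minimum on R^m, represented as m.-tuple R
   (which carries the product sigma-algebra of MathComp-Analysis). *)
Definition tjoin (R : realType) m (x y : m.-tuple R) : m.-tuple R :=
  [tuple Num.max (tnth x i) (tnth y i) | i < m].
Definition tmeet (R : realType) m (x y : m.-tuple R) : m.-tuple R :=
  [tuple Num.min (tnth x i) (tnth y i) | i < m].

Definition superadditive (R : realType) m (phi : m.-tuple R -> R) : Prop :=
  forall x y : m.-tuple R, phi x + phi y <= phi (tjoin x y) + phi (tmeet x y).

Definition expectation_exists d (T : measurableType d) (R : realType)
  (P : probability T R) (f : T -> R) : Prop :=
  measurable_fun setT f /\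
  ((\int[P]_w (Num.max (f w) 0)%:E < +oo)%E \/
   (\int[P]_w (Num.max (- f w) 0)%:E < +oo)%E).

Definition mutually_independent d (T : measurableType d) (R : realType)
  (P : probability T R) m (X : 'I_m -> T -> R) : Prop :=
  forall B : 'I_m -> set R, (forall i, measurable (B i)) ->
    P (\bigcap_(i in [set: 'I_m]) (X i @^-1` B i)) =
    (\prod_(i < m) P (X i @^-1` B i))%E.

Definition same_law d (T : measurableType d) d' (T' : measurableType d')
  (R : realType) (P : probability T R) (X : T -> R)
  (P' : probability T' R) (X' : T' -> R) : Prop :=
  forall B : set R, measurable B -> P (X @^-1` B) = P' (X' @^-1` B).

(* Negative superadditive dependence: for every superadditive (Borel) phi
   whose expectations exist, E phi(X) <= E phi(X^* ), where X^* is any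
   vector of independent random variables with the same marginals as X
   (the value E phi(X^* ) only depends on these marginals). *)
Definition NSD d (T : measurableType d) (R : realType) (P : probability T R)
  m (X : 'I_m -> T -> R) : Prop :=
  forall d' (T' : measurableType d') (P' : probability T' R)
         (Xs : 'I_m -> T' -> R),
    (forall i, measurable_fun setT (Xs i)) ->
    mutually_independent P' Xs ->
    (forall i, same_law P (X i) P' (Xs i)) ->
    forall phi : m.-tuple R -> R,
      measurable_fun setT phi -> superadditive phi ->
      expectation_exists P (fun w => phi [tuple X i w | i < m]) ->
      expectation_exists P' (fun w => phi [tuple Xs i w | i < m]) ->
      ('E_P[fun w => phi [tuple X i w | i < m]]
         <= 'E_P'[fun w => phi [tuple Xs i w | i < m]])%E.

(* t j stands for t_{j+1}; tau i = t_1 + ... + t_i, tau 0 = 0 *)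
Definition tau (T : Type) (R : realType) (t : nat -> T -> R) (i : nat) (w : T) : R :=
  \sum_(j < i) t j w.

Definition Yobs (T : Type) (R : realType) (a : R) (W : R -> T -> R)
  (t : nat -> T -> R) (i : nat) (w : T) : R :=
  a * tau t i w + W (tau t i w) w - W (tau t i.-1 w) w.

Definition ahat (T : Type) (R : realType) (a : R) (W : R -> T -> R)
  (t : nat -> T -> R) (N : nat) (w : T) : R :=
  (\sum_(1 <= i < N.+1) Yobs a W t i w * tau t i w) /
  (\sum_(1 <= i < N.+1) tau t i w ^+ 2).

(* Main.v *)
(**
  By Abel summation, N (hat a_N - a) is the quotient of
  (W_(tau_N) - W_1) tau_N + sum_i (W_1 - W_(tau_(i-1))) t_i by
  (1/N) sum_i tau_i^2. Suppose that W is continuous and that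
  max_(i <= N) |tau_i - i/N| tends to 0. Then W_(tau_N) - W_1 tends to 0, and
  both sums are Riemann sums on [0, 1]: the first one of W_1 - W_s with nodes
  tau_i, the second one of s^2 with nodes i/N and tags tau_i.

  This uniform closeness holds almost surely by Borel-Cantelli. For a monotone
  h the map x |-> exp (sum_i h x_i) is superadditive, so negative superadditive
  dependence bounds E exp (sum_i h t_i) by the product of the E exp (h t_i).
  Chernoff's inequality with h x = - lam x controls the lower deviations of
  tau_i, and with h x = lam min(x, 1/(2 lam)) the upper ones, up to the event
  that some t_j reaches 1/(2 lam), which the moment of order 2 + r controls.
  With lam = N^(r / (2 (2 + r))), all these probabilities together are
  O(N^(-1 - r/2)).
*)
Require Import Defs.
From HB Require Import structures.
From mathcomp Require Import all_boot all_order all_algebra.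
From mathcomp Require Import all_classical all_reals all_analysis.
From mathcomp Require Import measurable_realfun.
From mathcomp Require Import ring lra.
Import Order.TTheory GRing.Theory Num.Theory.
Import numFieldNormedType.Exports.
Local Open Scope classical_set_scope.
Local Open Scope ring_scope.
Set Implicit Arguments.
Unset Strict Implicit.

Section expR_powR_estimates.
Context {R : realType}.
Implicit Types c p s u x : R.

Lemma expR_le_quadratic u : u <= 2^-1 -> expR u <= 1 + u + 2 * u ^+ 2.
Proof.
move=> u2; have u1 : 0 < 1 - u by lra.
have expR_inv : expR u * (1 - u) <= 1.
  by rewrite -[leRHS](expRxMexpNx_1 u) ler_pM2l ?expR_gt0// expR_ge1Dx.
have inv_quadratic : 1 <= (1 + u + 2 * u ^+ 2) * (1 - u).
  by have := mulr_ge0 (sqr_ge0 u) (_ : 0 <= 1 - 2 * u); lra.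
by rewrite -(ler_pM2r u1) (le_trans expR_inv).
Qed.

Lemma expR_opp_powR_decay c s p : 0 < c -> 0 < s ->
  exists2 K : R, 0 < K & forall x, 1 <= x -> expR (- (c * x `^ s)) <= K / x `^ p.
Proof.
move=> c0 s0; pose n := Num.truncn (p / s).
have p_le : p <= s * n.+1%:R by rewrite mulrC -ler_pdivrMr// ltW// truncnS_gt.
exists (n.+1`!%:R / c ^+ n.+1); first by rewrite divr_gt0// exprn_gt0.
move=> x x1; have x0 : 0 < x by rewrite (lt_le_trans _ x1).
rewrite expRN -invf_div lef_pV2 ?posrE ?expR_gt0 ?divr_gt0 ?powR_gt0 ?exprn_gt0//.
apply: le_trans (expR_ge1Dxn n _); last by rewrite mulr_ge0 ?powR_ge0 ?ltW.
rewrite invf_div mulrA ler_wpDl// ler_pM2r ?invr_gt0//.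
rewrite exprMn mulrC ler_pM2l ?exprn_gt0//.
by rewrite -powR_mulrn ?powR_ge0// -powRrM ler_powR.
Qed.

Lemma powR_le_telescope s x : 0 < s -> 1 < x ->
  s / x `^ (1 + s) <= ((x - 1) `^ s)^-1 - (x `^ s)^-1.
Proof.
move=> s0 x1; have x0 : 0 < x by rewrite (lt_trans _ x1).
have y0 : 0 < x - 1 by rewrite subr_gt0.
pose l := ln (x / (x - 1)).
have l_ge : x^-1 <= l.
  have := expR_ge1Dx (- l).
  rewrite expRN lnK ?posrE ?divr_gt0// invf_div mulrBl divff ?gt_eqF//.
  by rewrite div1r lerD2l lerN2.
(* (x - 1)^-s = x^-s e^(s l) >= x^-s (1 + s l) *)
have -> : ((x - 1) `^ s)^-1 = (x `^ s)^-1 * expR (s * l).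
  by rewrite -!powRN /powR !gt_eqF// -expRD /l ln_div ?posrE//; congr expR; ring.
have -> : (x `^ (1 + s))^-1 = (x `^ s)^-1 * x^-1.
  by rewrite powRD ?(gt_eqF x0) ?implybT// powRr1 ?ltW// invfM mulrC.
rewrite mulrCA -[X in _ - X]mulr1 -mulrBr ler_wpM2l ?invr_ge0 ?powR_ge0//.
by rewrite lerBrDl (le_trans _ (expR_ge1Dx _))// lerD2l ler_wpM2l// ltW.
Qed.

Lemma nneseries_riemannR_lty c s : 0 <= c -> 0 < s ->
  (\sum_(n <oo) (c * riemannR (1 + s) n)%:E < +oo)%E.
Proof.
move=> c0 s0.
have partial_sum_le n : \sum_(0 <= i < n.+1) c * riemannR (1 + s) i <=
    c * (1 + s^-1 * (1 - riemannR s n)).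
  elim: n => [|n IH].
    by rewrite big_nat1 /riemannR !powR1 invr1 subrr mulr0 addr0.
  rewrite big_nat_recr//= (le_trans (lerD IH (lexx _)))// -mulrDr ler_wpM2l//.
  have : s * riemannR (1 + s) n.+1 <= riemannR s n - riemannR s n.+1.
    rewrite /riemannR -[in n.+1%:R](addrK 1 n.+1%:R) natr1.
    by rewrite powR_le_telescope// ltr1n.
  rewrite -ler_pdivlMl// => term_le; rewrite -addrA lerD2l -lerBrDl -mulrBr.
  by rewrite (le_trans term_le)// ler_pM2l ?invr_gt0//; lra.
apply: (@le_lt_trans _ _ (c * (1 + s^-1))%:E); last exact: ltry.
apply: lime_le.
  by apply: is_cvg_nneseries => n _ _; rewrite lee_fin mulr_ge0// invr_ge0 powR_ge0.
near=> n.
have -> : n = n.-1.+1 by rewrite prednK//; near: n; exists 1%N.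
rewrite sumEFin lee_fin (le_trans (partial_sum_le _))// ler_wpM2l// lerD2l.
by rewrite ler_piMr ?invr_ge0 ?(ltW s0)// gerBl invr_ge0 powR_ge0.
Unshelve. all: by end_near. Qed.

End expR_powR_estimates.

Lemma indic_bigcap_ord (T : Type) (R : comPzRingType) m (A : 'I_m -> set T) :
  \1_(\bigcap_(i in [set: 'I_m]) A i) = (fun w => \prod_(i < m) \1_(A i) w) :> (T -> R).
Proof.
apply/funext => w; have [Aw|/existsNP[i nAw]] := pselect (forall i, A i w).
  by rewrite indicE mem_set// big1// => i _; rewrite indicE mem_set.
rewrite (bigD1 i)//= !indicE (memNset nAw) mul0r memNset// => /(_ i I).
exact: nAw.
Qed.

Lemma ge0_expectation_product_measure d d' (T : measurableType d)
    (T' : measurableType d') (R : realType) (P : probability T R)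
    (P' : probability T' R) (f : T -> R) (g : T' -> R) :
  measurable_fun setT f -> measurable_fun setT g ->
  (forall w, 0 <= f w) -> (forall w, 0 <= g w) ->
  ('E_(P \x P')[fun z => (f z.1 * g z.2)%R] = 'E_P[f] * 'E_P'[g])%E.
Proof.
move=> mf mg f0 g0; rewrite unlock fubini_tonelli1 => [||z]; last 2 first.
- apply/measurable_EFinP; apply: measurable_funM.
    exact: (measurableT_comp mf measurable_fst).
  exact: (measurableT_comp mg measurable_snd).
- by rewrite lee_fin mulr_ge0.
rewrite -ge0_integralZr//; last 3 first.
- exact/measurable_EFinP.
- by move=> w _; rewrite lee_fin.
- by apply: integral_ge0 => w _; rewrite lee_fin.
apply: eq_integral => x _; rewrite /fubini_F /=.
under eq_integral do rewrite EFinM.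
rewrite ge0_integralZl_EFin//; first by move=> w _; rewrite lee_fin.
exact/measurable_EFinP.
Qed.

(* Applied to indicator functions, this product formula gives both the
   independence of the Y i and the equality in law of X i and Y i. *)
Definition factorizes_as_copies d d' (T : measurableType d) (T' : measurableType d')
    (R : realType) (P : probability T R) (P' : probability T' R) m
    (X : 'I_m -> {RV P >-> R}) (Y : 'I_m -> {RV P' >-> R}) :=
  forall g : 'I_m -> R -> R, (forall i, measurable_fun setT (g i)) ->
    (forall i x, 0 <= g i x) ->
    ('E_P'[fun w => (\prod_(i < m) g i (Y i w))%R] = \prod_(i < m) 'E_P[g i \o X i])%E.

Section independent_copies.
Context d (T : measurableType d) (R : realType) (P : probability T R).

Lemma exists_independent_copies m (X : 'I_m -> {RV P >-> R}) :
  exists (d' : measure_display) (T' : measurableType d') (P' : probability T' R)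
    (Y : 'I_m -> {RV P' >-> R}), factorizes_as_copies X Y.
Proof.
elim: m X => [|m IH] X.
  exists d, T, P, X => g _ _; rewrite big_ord0 -(expectation_cst P 1).
  by congr ('E_P[_])%E; apply/funext => w; rewrite big_ord0.
have [d' [T' [P' [Y factY]]]] := IH (X \o lift ord0).
pose Z i (z : T * T') := if unlift ord0 i is Some j then Y j z.2 else X ord0 z.1.
have mZ i : measurable_fun setT (Z i).
  by rewrite /Z; case: (unlift ord0 i) => [j|]; exact: measurableT_comp.
exists _, (T * T')%type, (P \x P')%E, (fun i => mfun_Sub (mem_set (mZ i))).
move=> g mg g0; pose F w := \prod_(i < m) g (lift ord0 i) (Y i w).
have mF : measurable_fun setT F.
  by apply: measurable_prod => i _; exact: measurableT_comp.
have F0 w : 0 <= F w by exact: prodr_ge0.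
have mG : measurable_fun setT (g ord0 \o X ord0) by exact: measurableT_comp.
rewrite big_ord_recl -(factY (fun i => g (lift ord0 i)))//.
rewrite -ge0_expectation_product_measure//; last by move=> w; exact: g0.
congr ('E__[_])%E; apply/funext => z; rewrite big_ord_recl /= /Z unlift_none.
by congr (_ * _); apply: eq_bigr => i _; rewrite liftK.
Qed.

Variables (d' : measure_display) (T' : measurableType d') (P' : probability T' R).
Variables (m : nat) (X : 'I_m -> {RV P >-> R}) (Y : 'I_m -> {RV P' >-> R}).
Hypothesis factXY : factorizes_as_copies X Y.

Lemma factorizes_same_law (i : 'I_m) : same_law P (X i) P' (Y i).
Proof.
move=> B mB.
have := factXY (g := fun j => if j == i then \1_B else cst 1).
rewrite (bigD1 i)//= eqxx big1 ?mule1; last first.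
  by move=> j /negPf ->; exact: expectation_cst.
under eq_fun => w.
  rewrite (bigD1 i)//= eqxx big1 ?mulr1; last by move=> j /negPf ->.
  over.
rewrite -(expectation_indic P (measurable_funPTI (X i) mB)).
rewrite -(expectation_indic P' (measurable_funPTI (Y i) mB)).
by move=> law_eq; apply/esym/law_eq => [j|j x]; case: ifP.
Qed.

Lemma factorizes_mutually_independent : mutually_independent P' Y.
Proof.
move=> B mB; have mYB i := measurable_funPTI (Y i) (mB i).
rewrite -expectation_indic; last exact: fin_bigcap_measurable.
rewrite indic_bigcap_ord.
under [RHS]eq_bigr do
  rewrite -factorizes_same_law// -(expectation_indic P (measurable_funPTI _ (mB _))).
by apply: (factXY (g := fun i => \1_(B i))).
Qed.

End independent_copies.

Definition weakly_monotone (R : realType) (h : R -> R) :=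
  {homo h : x y / x <= y} \/ {homo h : x y /~ x <= y}.

Lemma superadditive_expR_sum (R : realType) (m : nat) (h : R -> R) :
  weakly_monotone h ->
  superadditive (fun x : m.-tuple R => expR (\sum_(i < m) h (tnth x i))).
Proof.
move=> h_mono x y.
pose S z := \sum_(i < m) h (tnth z i).
have S_modular : S (tjoin x y) + S (tmeet x y) = S x + S y.
  rewrite -!big_split/=; apply: eq_bigr => i _.
  by rewrite !tnth_mktuple; case: leP => // _; rewrite addrC.
have prod_ge0 : 0 <= (expR (S (tjoin x y)) - expR (S x)) *
                     (expR (S (tjoin x y)) - expR (S y)).
  case: h_mono => h_mono; [apply: mulr_ge0|apply: mulr_le0];
    rewrite (subr_ge0, subr_le0) ler_expR; apply: ler_sum => i _; apply: h_mono;
    by rewrite tnth_mktuple le_max lexx ?orbT.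
have expR_modular : expR (S (tjoin x y)) * expR (S (tmeet x y)) =
    expR (S x) * expR (S y) by rewrite -!expRD S_modular.
(* With j, k, a, b the values of exp S at the join, the meet, x and y, one has
   (j - a) (j - b) = j (j + k - a - b), since j k = a b. *)
rewrite -/(S x) -/(S y) -subr_ge0 -(pmulr_rge0 _ (expR_gt0 (S (tjoin x y)))).
by move: prod_ge0 expR_modular; rewrite /S; nra.
Qed.

Lemma ge0_expectation_exists d (T : measurableType d) (R : realType)
    (P : probability T R) (f : T -> R) :
  measurable_fun setT f -> (forall w, 0 <= f w) -> expectation_exists P f.
Proof.
move=> mf f0; split=> //; right.
by rewrite integral0_eq// => w _; congr _%:E; apply/max_idPr; rewrite oppr_le0.
Qed.

Lemma lee_prod (R : realDomainType) I (r : seq I) (P : pred I) (f g : I -> \bar R) :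
  (forall i, P i -> (0 <= f i <= g i)%E) ->
  (\prod_(i <- r | P i) f i <= \prod_(i <- r | P i) g i)%E.
Proof.
move=> fg.
suff /andP[] : (0 <= \prod_(i <- r | P i) f i <= \prod_(i <- r | P i) g i)%E by [].
elim/big_ind2 : _ => [|y1 x1 y2 x2 /andP[x1_ge0 xy1] /andP[x2_ge0 xy2]|i /fg]//.
  by rewrite lexx lee01.
by apply/andP; split; [exact: mule_ge0|exact: lee_pmul].
Qed.

Section NSD_exponential_moments.
Context d (T : measurableType d) (R : realType) (P : probability T R).
Variables (m : nat) (X : 'I_m -> {RV P >-> R}) (h : R -> R).
Hypotheses (nsdX : NSD P X) (mh : measurable_fun setT h) (h_mono : weakly_monotone h).

Lemma NSD_expectation_expR_sum :
  ('E_P[fun w => expR (\sum_(i < m) h (X i w))%R] <=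
   \prod_(i < m) 'E_P[expR \o h \o X i])%E.
Proof.
have [d' [T' [P' [Y factXY]]]] := exists_independent_copies X.
pose phi (x : m.-tuple R) := expR (\sum_(i < m) h (tnth x i)).
have mphi : measurable_fun setT phi.
  apply: measurableT_comp => //; apply: measurable_sum => i.
  by apply: measurableT_comp => //; exact: measurable_tnth.
have phi_exists d1 (T1 : measurableType d1) (Q : probability T1 R)
    (Z : 'I_m -> {RV Q >-> R}) :
    expectation_exists Q (fun w => phi [tuple Z i w | i < m]).
  apply: ge0_expectation_exists => [|w]; last exact: expR_ge0.
  apply: measurableT_comp => //; apply/measurable_fun_tnthP => i.
  by apply: (eq_measurable_fun (Z i)) => // w _ /=; rewrite tnth_mktuple.
have phiE (z : 'I_m -> R) : phi [tuple z i | i < m] = expR (\sum_(i < m) h (z i)).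
  by rewrite /phi; under eq_bigr do rewrite tnth_mktuple.
rewrite -(factXY (fun _ => expR \o h)); last 2 first.
- by move=> i; exact: measurableT_comp.
- by move=> i x; exact: expR_ge0.
rewrite (_ : (fun w => _) = fun w => phi [tuple X i w | i < m]); last first.
  by apply/funext => w; rewrite phiE.
rewrite (_ : (fun w => \prod_(i < m) _) =
    fun w => phi [tuple Y i w | i < m]); last first.
  by apply/funext => w; rewrite phiE expR_sum.
exact: (nsdX (fun i => measurable_funPT (Y i))
  (factorizes_mutually_independent factXY) (factorizes_same_law factXY) mphi
  (superadditive_expR_sum h_mono) (phi_exists _ _ _ X) (phi_exists _ _ _ Y)).
Qed.

Lemma NSD_chernoff (k : 'I_m -> R) (c : R) :
  (forall i, 'E_P[expR \o h \o X i] <= (expR (k i))%:E)%E ->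
  (P [set w | (c <= \sum_(i < m) h (X i w))%R] <=
   (expR (\sum_(i < m) k i - c))%:E)%E.
Proof.
move=> Ek.
have mS : measurable_fun setT (fun w => \sum_(i < m) h (X i w)).
  by apply: measurable_sum => i; exact: measurableT_comp.
have := @chernoff _ _ _ P (mfun_Sub (mem_set mS)) 1 c ltr01.
move=> /le_trans; apply; rewrite mul1r expRD EFinM lee_wpmul2r ?lee_fin ?expR_ge0//.
rewrite /mmt_gen_fun /=.
rewrite (_ : expR \o _ = fun w => expR (\sum_(i < m) h (X i w))); last first.
  by apply/funext => w /=; rewrite mulr1.
apply: le_trans NSD_expectation_expR_sum _; rewrite expR_sum -prodEFin.
by apply: lee_prod => i _; rewrite Ek expectation_ge0// => w; exact: expR_ge0.
Qed.

End NSD_exponential_moments.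

Section moments.
Context d (T : measurableType d) (R : realType) (P : probability T R).
Implicit Types (f : T -> R) (X : {RV P >-> R}).

Lemma ge0_Lfun1 f : measurable_fun setT f -> (forall w, 0 <= f w) ->
  ('E_P[f] < +oo)%E -> f \in Lfun P 1.
Proof.
move=> mf f0; rewrite unlock => Ef; apply/Lfun1_integrable/integrableP.
split; first exact/measurable_EFinP.
by under eq_integral do rewrite gee0_abs ?lee_fin//.
Qed.

Lemma expectation_expR_le X (h : R -> R) (s q mu v : R) :
  measurable_fun setT h -> (forall w, 0 <= X w) ->
  ('E_P[X] = mu%:E)%E -> ('E_P[fun w => (X w ^+ 2)%R] <= v%:E)%E -> 0 <= q ->
  (forall x, 0 <= x -> expR (h x) <= 1 + s * x + q * x ^+ 2) ->
  ('E_P[expR \o h \o X] <= (expR (s * mu + q * v))%:E)%E.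
Proof.
move=> mh X0 EX EX2 q0 h_le.
pose X2 w := X w ^+ 2.
have mX2 : measurable_fun setT X2 by exact: measurable_funX.
have LX : (X : T -> R) \in Lfun P 1 by rewrite ge0_Lfun1// EX ltry.
have LX2 : X2 \in Lfun P 1.
  by rewrite ge0_Lfun1 ?(le_lt_trans EX2) ?ltry// => w; exact: sqr_ge0.
have Lcst : cst 1 \in Lfun P 1 by exact: Lfun_cst.
pose quad : T -> R := cst 1 \+ s \o* X \+ q \o* X2.
have h_le_quad w : expR (h (X w)) <= quad w.
  by rewrite /quad/= ![_ * s]mulrC [_ * q]mulrC h_le.
have Equad : ('E_P[quad] = 1 + s%:E * mu%:E + q%:E * 'E_P[X2])%E.
  by rewrite !expectationD ?expectationZl ?expectation_cst ?EX// ?rpredD ?Lfun_scale.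
apply: (@le_trans _ _ ('E_P[quad])%E).
  apply: expectation_le => //.
  - by apply: measurableT_comp => //; exact: measurableT_comp.
  - apply: measurable_funD; [apply: measurable_funD => //|]; exact: measurable_funM.
  - by move=> w; exact: expR_ge0.
  - by move=> w; exact: le_trans (expR_ge0 _) (h_le_quad w).
  - exact: aeW.
rewrite Equad (@le_trans _ _ (1 + s%:E * mu%:E + q%:E * v%:E)%E)//.
  by rewrite leeD2l// lee_wpmul2l.
by rewrite -!EFinM -!EFinD lee_fin -addrA expR_ge1Dx.
Qed.

Lemma powR_markov X (p b M : R) : (forall w, 0 <= X w) -> 0 <= p -> 0 < b ->
  ('E_P[fun w => (X w `^ p)%R] <= M%:E)%E ->
  (P [set w | (b <= X w)%R] <= (M / b `^ p)%:E)%E.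
Proof.
move=> X0 p0 b0; rewrite EFinM lee_pdivlMr ?powR_gt0// muleC.
apply: le_trans; have := @markov _ _ _ P X (fun x => x `^ p) b b0 (measurable_powR p).
move=> /(_ (fun x _ => powR_ge0 x p)) /(_ (ge0_ler_powR p0)).
under eq_set do rewrite abse_EFin ger0_norm// lee_fin.
rewrite (_ : _ \o X = fun w => X w `^ p)//.
by apply/funext => w /=; rewrite ger0_norm.
Qed.

Lemma second_moment_le X (p b M : R) : (forall w, 0 <= X w) -> 2 <= p -> 0 < b ->
  ('E_P[fun w => (X w `^ p)%R] <= (M * b `^ p)%:E)%E ->
  ('E_P[fun w => (X w ^+ 2)%R] <= ((1 + M) * b ^+ 2)%:E)%E.
Proof.
move=> X0 p2 b0 EXp.
pose Xp w := X w `^ p.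
have mXp : measurable_fun setT Xp by exact: (measurableT_comp (measurable_powR p)).
have LXp : Xp \in Lfun P 1.
  by rewrite ge0_Lfun1 ?(le_lt_trans EXp) ?ltry// => w; exact: powR_ge0.
pose c := b ^+ 2 / b `^ p.
have c0 : 0 <= c by rewrite divr_ge0 ?sqr_ge0 ?powR_ge0.
have powR_sqr x : 0 < x -> x `^ p = x ^+ 2 * x `^ (p - 2).
  by move=> x0; rewrite -powR_mulrn ?ltW// -powRD ?subrKC// (gt_eqF x0) implybT.
have sqr_le x : 0 <= x -> x ^+ 2 <= b ^+ 2 + x `^ p * c.
  move=> x0; have [xb|/ltW bx] := leP x b.
    apply: ler_wpDr; first by rewrite mulr_ge0 ?powR_ge0.
    by rewrite ler_sqr ?nnegrE ?(ltW xb) ?(ltW b0).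
  rewrite ler_wpDl ?sqr_ge0// /c mulrA ler_pdivlMr ?powR_gt0//.
  rewrite !powR_sqr// ?(lt_le_trans b0)// -[leRHS]mulrA ler_wpM2l ?sqr_ge0//.
  rewrite [leRHS]mulrC ler_wpM2l ?sqr_ge0//.
  by rewrite ge0_ler_powR ?nnegrE ?subr_ge0// ltW.
pose bound : T -> R := cst (b ^+ 2) \+ c \o* Xp.
apply: (@le_trans _ _ ('E_P[bound])%E).
  apply: expectation_le => //.
  - exact: measurable_funX.
  - by apply: measurable_funD => //; exact: measurable_funM.
  - by move=> w; exact: sqr_ge0.
  - by move=> w; exact: le_trans (sqr_ge0 _) (sqr_le _ (X0 w)).
  - by apply: aeW => w; exact: sqr_le.
rewrite expectationD ?expectationZl ?Lfun_cst//; last by rewrite Lfun_scale.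
rewrite expectation_cst mulrDl mul1r EFinD leeD2l//.
rewrite (le_trans (lee_wpmul2l _ EXp)) ?lee_fin//.
by rewrite /c mulrCA mulfVK// gt_eqF// powR_gt0.
Qed.

End moments.

Lemma measurable_set_le d (T : measurableType d) (R : realType) (f g : T -> R) :
  measurable_fun setT f -> measurable_fun setT g -> measurable [set w | f w <= g w].
Proof.
move=> mf mg; rewrite -[X in measurable X]setTI.
exact: (measurable_fun_ler mf mg measurableT (Y := [set true])).
Qed.

Lemma measurable_tau d (T : measurableType d) (R : realType) (t : nat -> T -> R) i :
  (forall j, measurable_fun setT (t j)) -> measurable_fun setT (tau t i).
Proof. by move=> mt; exact: measurable_sum. Qed.

Lemma measure_bigcup_ord_le d (T : measurableType d) (R : realFieldType)
    (mu : {content set T -> \bar R}) n (A : nat -> set T) :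
  (forall i, measurable (A i)) ->
  (mu (\bigcup_(i < n) A i) <= \sum_(i < n) mu (A i))%E.
Proof. by move=> mA; rewrite bigcup_mkord; exact: Boole_inequality. Qed.

Definition max_deviation_ge (T : Type) (R : realType) (t : nat -> T -> R) (n : nat)
    (mu x : R) : set T :=
  \bigcup_(i < n.+1) [set w | x <= `|tau t i w - i%:R * mu|].

Lemma max_deviation_ge_sub (T : Type) (R : realType) (t : nat -> T -> R) n
    (mu x b : R) :
  max_deviation_ge t n mu x `<=`
    \bigcup_(i < n.+1)
      ([set w | tau t i w <= i%:R * mu - x] `|`
       [set w | i%:R * mu + x <= \sum_(j < i) Num.min (t j w) b]) `|`
    \bigcup_(j < n) [set w | b <= t j w].
Proof.
move=> w [i /= i_n dev].
have [t_large|t_small] := pselect ((\bigcup_(j < n) [set w | b <= t j w]) w).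
  by right.
left; exists i => //; have truncE : \sum_(j < i) Num.min (t j w) b = tau t i w.
  apply: eq_bigr => j _; apply/min_idPl/ltW; rewrite ltNge; apply/negP => b_le.
  by apply: t_small; exists j => //; rewrite /= (leq_trans (ltn_ord j)).
by move: dev; rewrite /= truncE ler_normr => /orP[|] dev; [right|left]; lra.
Qed.

Lemma measurable_max_deviation_ge d (T : measurableType d) (R : realType)
    (t : nat -> T -> R) n mu x :
  (forall j, measurable_fun setT (t j)) -> measurable (max_deviation_ge t n mu x).
Proof.
move=> mt; apply: bigcup_measurable => i _; apply: measurable_set_le => //.
apply: measurableT_comp => //; apply: measurable_funB => //; exact: measurable_tau.
Qed.

Section NSD_deviation.
Context d (T : measurableType d) (R : realType) (P : probability T R).
Variables (X : nat -> {RV P >-> R}) (mu v : R).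
Hypotheses (X_ge0 : forall i w, 0 <= X i w) (EX : forall i, ('E_P[X i] = mu%:E)%E)
  (EX2 : forall i, ('E_P[fun w => (X i w ^+ 2)%R] <= v%:E)%E)
  (nsdX : forall m, NSD P (fun i : 'I_m => X i)).

Lemma NSD_lower_tail m (lam x : R) : 0 < lam ->
  (P [set w | (tau X m w <= m%:R * mu - x)%R] <=
   (expR (m%:R * (2 * lam ^+ 2 * v) - lam * x))%:E)%E.
Proof.
move=> lam0; pose h y := - (lam * y).
have mh : measurable_fun setT h.
  by apply: measurableT_comp => //; exact: mulrl_measurable.
have h_mono : weakly_monotone h by right => y z yz; rewrite lerN2 ler_pM2l.
have Eh i : ('E_P[expR \o h \o X i] <=
    (expR (- lam * mu + 2 * lam ^+ 2 * v))%:E)%E.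
  apply: expectation_expR_le => //; first by rewrite mulr_ge0 ?sqr_ge0.
  move=> y y0; have := @expR_le_quadratic R (h y).
  rewrite /h sqrrN exprMn mulNr mulrA; apply.
  by rewrite (@le_trans _ _ 0)// oppr_le0 mulr_ge0// ltW.
have := NSD_chernoff (@nsdX m) mh h_mono (lam * x - lam * (m%:R * mu))
  (fun i : 'I_m => Eh i).
rewrite sumr_const card_ord -[X in expR (X - _)]mulr_natl.
rewrite (_ : [set w | _ <= _] = [set w | tau X m w <= m%:R * mu - x]); last first.
  apply/eq_set => w; rewrite /h sumrN -mulr_sumr -/(tau X m w).
  by rewrite -mulrBr lerNr -mulrN opprB ler_pM2l.
by rewrite [X in expR X](_ : _ = m%:R * (2 * lam ^+ 2 * v) - lam * x)//; ring.
Qed.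

Lemma NSD_truncated_upper_tail m (lam x : R) : 0 < lam ->
  (P [set w | (m%:R * mu + x <= \sum_(i < m) Num.min (X i w) (2 * lam)^-1)%R] <=
   (expR (m%:R * (2 * lam ^+ 2 * v) - lam * x))%:E)%E.
Proof.
move=> lam0; pose b := (2 * lam)^-1; pose h y := lam * Num.min y b.
have b0 : 0 < b by rewrite invr_gt0 mulr_gt0.
have mh : measurable_fun setT h.
  by apply: (measurableT_comp (mulrl_measurable lam)); exact: measurable_minr.
have h_mono : weakly_monotone h.
  by left => y z yz; rewrite ler_pM2l// le_min !ge_min lexx yz orbT.
have Eh i : ('E_P[expR \o h \o X i] <= (expR (lam * mu + 2 * lam ^+ 2 * v))%:E)%E.
  apply: expectation_expR_le => //; first by rewrite mulr_ge0 ?sqr_ge0.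
  move=> y y0; have min_ge0 : 0 <= Num.min y b by rewrite le_min y0 ltW.
  have min_le : Num.min y b <= y by rewrite ge_min lexx.
  have h_le : h y <= 2^-1.
    rewrite -ler_pdivlMl// -invfM mulrC.
    by rewrite ge_min lexx orbT.
  apply: le_trans (expR_le_quadratic h_le) _.
  by rewrite exprMn mulrA !lerD ?ler_wpM2l ?mulr_ge0 ?sqr_ge0 ?lerXn2r ?nnegrE// ltW.
have := NSD_chernoff (@nsdX m) mh h_mono (lam * (m%:R * mu) + lam * x)
  (fun i : 'I_m => Eh i).
rewrite sumr_const card_ord -[X in expR (X - _)]mulr_natl.
rewrite (_ : [set w | _ <= _] =
    [set w | m%:R * mu + x <= \sum_(i < m) Num.min (X i w) b]); last first.
  by apply/eq_set => w; rewrite /h -mulr_sumr -mulrDr ler_pM2l.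
by rewrite [X in expR X](_ : _ = m%:R * (2 * lam ^+ 2 * v) - lam * x)//; ring.
Qed.

Lemma NSD_max_deviation n (lam x : R) : 0 < lam ->
  (P (max_deviation_ge X n mu x) <=
   (n.+1%:R * (2 * expR (n%:R * (2 * lam ^+ 2 * v) - lam * x)))%:E +
   \sum_(j < n) P [set w | ((2 * lam)^-1 <= X j w)%R])%E.
Proof.
move=> lam0; set b := (2 * lam)^-1; set D := expR _.
pose lower i := [set w | tau X i w <= i%:R * mu - x].
pose upper i := [set w | i%:R * mu + x <= \sum_(j < i) Num.min (X j w) b].
pose large j := [set w | b <= X j w].
have mlower i : measurable (lower i).
  by apply: measurable_set_le => //; exact: measurable_tau.
have mupper i : measurable (upper i).
  apply: measurable_set_le => //; apply: measurable_sum => j.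
  exact: measurable_minr.
have mlarge j : measurable (large j) by exact: measurable_set_le.
have v0 : 0 <= v.
  rewrite -lee_fin (le_trans _ (EX2 0%N))// expectation_ge0// => w.
  exact: sqr_ge0.
have mtails i : measurable (lower i `|` upper i) by exact: measurableU.
have tails i : (i < n.+1)%N -> (P (lower i `|` upper i) <= (2 * D)%:E)%E.
  move=> i_n; have D_ge : expR (i%:R * (2 * lam ^+ 2 * v) - lam * x) <= D.
    rewrite ler_expR lerD2r ler_wpM2r ?ler_nat//.
    by rewrite mulr_ge0// mulr_ge0// sqr_ge0.
  rewrite (le_trans (measureU2 _ _ _))// mulr_natl mulr2n EFinD leeD//.
    by rewrite (le_trans (NSD_lower_tail _ _ lam0))// lee_fin.
  by rewrite (le_trans (NSD_truncated_upper_tail _ _ lam0))// lee_fin.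
have mtails_bigcup : measurable (\bigcup_(i < n.+1) (lower i `|` upper i)).
  by apply: bigcup_measurable => i _.
have mlarge_bigcup : measurable (\bigcup_(j < n) large j).
  by apply: bigcup_measurable => j _.
apply: (le_trans (le_measure P _ _ (@max_deviation_ge_sub _ _ X n mu x b)));
  rewrite ?inE//.
- exact: measurable_max_deviation_ge.
- exact: measurableU.
apply: (le_trans (measureU2 P mtails_bigcup mlarge_bigcup)); apply: leeD.
  apply: (le_trans (measure_bigcup_ord_le P _ mtails)).
  apply: (le_trans (lee_sum _ (fun (i : 'I_n.+1) _ => tails i (ltn_ord i)))).
  by rewrite sumEFin sumr_const card_ord lee_fin [leRHS]mulr_natl.
exact: measure_bigcup_ord_le.
Qed.

End NSD_deviation.

Lemma powRV (R : realType) (x p : R) : 0 <= x -> x^-1 `^ p = (x `^ p)^-1.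
Proof. by move=> x0; rewrite -powR_inv1// -powRrM mulN1r powRN. Qed.

(* With lam = x^s and s = r / (2 (2 + r)), the variance term x lam^2 / x^2 stays
   bounded while lam^(2 + r) = x^(r / 2). *)
Lemma max_deviation_rate (R : realType) (r C e : R) : 0 < r -> 0 <= C -> 0 < e ->
  exists2 K : R, 0 <= K & forall x : R, 1 <= x -> exists2 lam : R, 0 < lam &
    (x + 1) * (2 * expR (x * (2 * lam ^+ 2 * ((1 + C) * x^-1 ^+ 2)) - lam * e)) +
    x * (C * x^-1 `^ (2 + r) / (2 * lam)^-1 `^ (2 + r)) <= K / x `^ (1 + r / 2).
Proof.
move=> r0 C0 e0; pose p := 2 + r; pose s := r / (2 * p).
have p0 : 0 < p by rewrite addr_gt0.
have s0 : 0 < s by rewrite divr_gt0// mulr_gt0.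
have [K K0 expR_decay] := expR_opp_powR_decay (1 + (1 + r / 2)) e0 s0.
pose D := expR (2 * (1 + C)); have D0 : 0 < D := expR_gt0 _.
exists (4 * (D * K) + C * 2 `^ p).
  by rewrite addr_ge0 ?mulr_ge0 ?powR_ge0 ?(ltW D0) ?(ltW K0).
move=> x x1; have x0 : 0 < x by rewrite (lt_le_trans _ x1).
have powR_add a b : x `^ (a + b) = x `^ a * x `^ b.
  by rewrite powRD// (gt_eqF x0) implybT.
have powRx1 : x `^ 1 = x by rewrite powRr1// ltW.
pose lam := x `^ s; have lam0 : 0 < lam by exact: powR_gt0.
exists lam => //; rewrite [leRHS]mulrDl; apply: lerD.
  have lam2 : lam ^+ 2 <= x.
    rewrite -powR_mulrn ?powR_ge0// -powRrM -[leRHS]powRx1 ler_powR//.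
    rewrite /s (_ : _ * 2 = r / p); last by field; rewrite gt_eqF.
    by rewrite ler_pdivrMr// mul1r lerDr.
  have exponent_le : x * (2 * lam ^+ 2 * ((1 + C) * x^-1 ^+ 2)) <= 2 * (1 + C).
    rewrite (_ : _ * _ = 2 * (1 + C) * (lam ^+ 2 / x)); last by field; rewrite gt_eqF.
    by rewrite ler_piMr ?ler_pdivrMr ?mul1r// mulr_ge0// addr_ge0.
  have expR_le : expR (x * (2 * lam ^+ 2 * ((1 + C) * x^-1 ^+ 2)) - lam * e) <=
      D * K / (x * x `^ (1 + r / 2)).
    rewrite expRD -[leRHS]mulrA /D ler_pM ?expR_ge0 ?ler_expR// [lam * e]mulrC.
    by rewrite (le_trans (expR_decay x x1))// powR_add powRx1.
  rewrite [leRHS](_ : _ = (x + x) * (2 * (D * K / (x * x `^ (1 + r / 2))))).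
    by rewrite ler_pM ?mulr_ge0 ?expR_ge0 ?addr_ge0 ?lerD2l ?ler_pM2l// ltW.
  by field; rewrite !gt_eqF ?powR_gt0.
have lam_p : lam `^ p = x `^ (r / 2).
  by rewrite -powRrM; congr (_ `^ _); rewrite /s; field; rewrite gt_eqF.
rewrite !powRV ?powRM ?mulr_ge0 ?(ltW x0) ?(ltW lam0)// invrK lam_p.
have -> : x `^ p = x * (x `^ (1 + r / 2) * x `^ (r / 2)).
  by rewrite -[X in X * (_ * _)]powRx1 -!powR_add; congr (_ `^ _); rewrite /p; field.
rewrite [leLHS](_ : _ = C * 2 `^ p / x `^ (1 + r / 2))//.
by field; rewrite !gt_eqF ?powR_gt0.
Qed.

Lemma borel_cantelli_near d (T : measurableType d) (R : realType)
    (mu : {measure set T -> \bar R}) (A : (set T) ^nat) :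
  (forall n, measurable (A n)) -> (\sum_(n <oo) mu (A n) < +oo)%E ->
  {ae mu, forall w, \forall n \near \oo, ~ A n w}.
Proof.
move=> mA sum_lty; exists (lim_sup_set A); split.
- by apply: bigcap_measurable => // n _; exact: bigcup_measurable.
- exact: lim_sup_set_cvg0.
move=> w /= not_near n _; apply: contrapT => not_bigcup; apply: not_near.
by exists n => // k /= nk Ak; apply: not_bigcup; exists k.
Qed.

Definition uniformly_close_to_grid (R : realType) (x : nat -> nat -> R) :=
  forall e : R, 0 < e -> \forall n \near \oo, forall i, (i <= n)%N ->
    `|x n i - i%:R / n%:R| < e.

Section NSD_close_to_grid.
Context d (T : measurableType d) (R : realType) (P : probability T R).
Variables (X : nat -> nat -> {RV P >-> R}) (r C : R).
Hypotheses (X_ge0 : forall n i w, 0 <= X n i w)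
  (EX : forall n i, (0 < n)%N -> ('E_P[X n i] = (n%:R^-1)%:E)%E)
  (r0 : 0 < r) (C0 : 0 <= C)
  (EXp : forall n i, (0 < n)%N ->
    ('E_P[fun w => (X n i w `^ (2 + r))%R] <= (C / n%:R `^ (2 + r))%R%:E)%E)
  (nsdX : forall n m, (0 < n)%N -> NSD P (fun i : 'I_m => X n i)).

Lemma NSD_max_deviation_rate (e : R) : 0 < e ->
  exists2 K : R, 0 <= K & forall n, (0 < n)%N ->
    (P (max_deviation_ge (X n) n n%:R^-1 e) <= (K / n%:R `^ (1 + r / 2))%:E)%E.
Proof.
move=> e0; have [K K0 rate] := max_deviation_rate r0 C0 e0.
exists K => // n n0; have n_gt0 : 0 < n%:R :> R by rewrite ltr0n.
have [|lam lam0 rate_lam] := rate n%:R; first by rewrite ler1n.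
have EXp_inv i : ('E_P[fun w => (X n i w `^ (2 + r))%R] <=
    (C * n%:R^-1 `^ (2 + r))%:E)%E.
  by rewrite powRV ?ler0n// EXp.
have EX2 i : ('E_P[fun w => (X n i w ^+ 2)%R] <= ((1 + C) * n%:R^-1 ^+ 2)%:E)%E.
  by apply: (second_moment_le _ _ _ (EXp_inv i)); rewrite ?invr_gt0 ?lerDl ?ltW.
have large i : (P [set w | ((2 * lam)^-1 <= X n i w)%R] <=
    (C * n%:R^-1 `^ (2 + r) / (2 * lam)^-1 `^ (2 + r))%:E)%E.
  by apply: powR_markov (EXp_inv i); rewrite ?invr_gt0 ?mulr_gt0 ?addr_ge0 ?ltW.
apply: (le_trans (NSD_max_deviation (X_ge0 n) (fun i => EX i n0) EX2
  (fun m => @nsdX n m n0) n e lam0)); rewrite -lee_fin EFinD in rate_lam.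
apply: le_trans rate_lam; rewrite -natr1 leeD2l//.
apply: le_trans (lee_sum _ (fun (i : 'I_n) _ => large i)) _.
by rewrite sumEFin sumr_const card_ord lee_fin [leRHS]mulr_natl.
Qed.

Lemma NSD_close_to_grid_ae :
  {ae P, forall w, uniformly_close_to_grid (fun n i => tau (X n) i w)}.
Proof.
suff close_natSinv (k : nat) : {ae P, forall w, \forall n \near \oo,
    ~ max_deviation_ge (X n) n n%:R^-1 k.+1%:R^-1 w}.
  apply: filterS (ae_foralln close_natSinv) => w close e e0.
  have [k _ k_lt] := near_infty_natSinv_lt (PosNum e0).
  apply: filterS (close k) => n not_dev i i_n.
  apply: lt_trans (k_lt k (leqnn k)); rewrite ltNge; apply/negP => dev.
  by apply: not_dev; exists i.
have [|K K0 rate] := @NSD_max_deviation_rate k.+1%:R^-1; first by rewrite invr_gt0.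
have : {ae P, forall w, \forall n \near \oo,
    ~ max_deviation_ge (X n.+1) n.+1 n.+1%:R^-1 k.+1%:R^-1 w}.
  apply: borel_cantelli_near => [n|]; first exact: measurable_max_deviation_ge.
  have r2 : 0 < r / 2 by rewrite divr_gt0.
  apply: le_lt_trans (nneseries_riemannR_lty K0 r2).
  by apply: lee_nneseries => n _; rewrite ?measure_ge0 ?rate.
by apply: filterS => w; exact: near_inftyS.
Qed.

End NSD_close_to_grid.

Section real_analysis.
Context {R : realType}.

Lemma within_itvcy_continuous_max (f : R -> R) (a : R) :
  {within `[a, +oo[, continuous f} -> continuous (fun s => f (Num.max s a)).
Proof.
move=> cf x; have max_ge s : `[a, +oo[%classic (Num.max s a).
  by rewrite /= in_itv/= andbT le_max lexx orbT.
have cmax : {for x, continuous (fun s => Num.max s a)}.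
  by apply: (@continuous_max R R id (cst a)); [exact: cvg_id|exact: cvg_cst].
have cf_max := (subspace_continuousP _ f).1 cf _ (max_ge x).
apply: cvg_trans cf_max => U /= nearU.
have : \forall s \near x, `[a, +oo[%classic (Num.max s a) -> U (f (Num.max s a)).
  exact: cmax nearU.
by apply: filterS => s /(_ (max_ge s)).
Qed.

Lemma compact_uniform_continuity (V W : normedModType R) (K : set V) (g : V -> W)
    (e : R) :
  compact K -> continuous g -> 0 < e ->
  \forall del \near 0^'+, forall x y, K x -> `|x - y| < del -> `|g x - g y| < e.
Proof.
move=> /compact_near_coveringP covK cg e0.
suff : \forall del \near 0^'+, K `<=`
    (fun x => forall y, `|x - y| < del -> `|g x - g y| < e).
  by apply: filterS => del Kdel x y Kx; exact: Kdel.
apply: covK => x _.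
have /cvgrPdist_lt /(_ (e / 2)) := cg x.
rewrite divr_gt0// => /(_ isT) /nbhs_ballP[eta /= eta0 near_x].
exists (ball x (eta / 2), [set s | 0 < s < eta / 2]) => /=.
  split; first by apply: nbhsx_ballx; rewrite divr_gt0.
  near=> s; apply/andP; split; near: s; first exact: nbhs_right_gt.
  by apply: nbhs_right_lt; rewrite divr_gt0.
move=> [z s]/= [xz /andP[s0 s_lt]] y zy.
have gxz : `|g x - g z| < e / 2.
  by apply: near_x; apply: le_ball xz; rewrite ler_pdivrMr// ler_peMr ?ler1n// ltW.
have gxy : `|g x - g y| < e / 2.
  apply: near_x; rewrite /= (splitr eta).
  by apply: (ball_triangle xz); rewrite -ball_normE; exact: lt_trans s_lt.
by rewrite -(subrKA (g x)) (splitr e) (le_lt_trans (ler_normD _ _))// ltrD// distrC.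
Unshelve. all: by end_near. Qed.

Lemma continuous_integrable_itv (g : R -> R) (a b : R) : continuous g ->
  lebesgue_measure.-integrable `[a, b] (EFin \o g).
Proof.
move=> cg; apply: continuous_compact_integrable; first exact: segment_compact.
exact: continuous_subspaceT.
Qed.

Lemma is_derive_Rintegral (g : R -> R) (a x : R) : continuous g -> a < x ->
  is_derive x 1 (fun z => \int[lebesgue_measure]_(s in `[a, z]) g s) (g x).
Proof.
move=> cg ax; have x1 : x < x + 1 by rewrite ltrDl.
have [|||dF <-] := @continuous_FTC1 R g (BLeft a) x (x + 1) x1.
- exact: continuous_integrable_itv.
- by rewrite lte_fin.
- exact: cg.
by rewrite derive1E; exact: derivableP.
Qed.

Lemma Rintegral_itv_sub (g : R -> R) (a b c : R) : continuous g -> a <= b -> b <= c ->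
  \int[lebesgue_measure]_(s in `[b, c]) g s =
  \int[lebesgue_measure]_(s in `[a, c]) g s - \int[lebesgue_measure]_(s in `[a, b]) g s.
Proof.
move=> cg ab bc; rewrite Rintegral_itvB ?bnd_simp//; last first.
  exact: continuous_integrable_itv.
rewrite Rintegral_itv_obnd_cbnd//.
apply: integrableS (continuous_integrable_itv b c cg) => //.
exact: subset_itv_oc_cc.
Qed.

Section riemann_sums.
Variables (g F : R -> R) (a : R).
Hypotheses (cg : continuous g) (dF : forall s, a <= s -> is_derive s 1 F (g s)).

Let cF s : a <= s -> {for s, continuous F}.
Proof.
move=> s0; apply: differentiable_continuous; apply/derivable1_diffP.
by have [] := dF s0.
Qed.

Lemma riemann_sum_error_le (y xi : nat -> R) (n : nat) (e : R) :
  nondecreasing_seq y -> y 0%N = a ->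
  (forall i s, (i < n)%N -> y i <= s <= y i.+1 -> `|g (xi i) - g s| <= e) ->
  `|\sum_(i < n) g (xi i) * (y i.+1 - y i) - (F (y n) - F a)| <= e * (y n - a).
Proof.
move=> y_nd y0 osc; have y_ge i : a <= y i by rewrite -y0 y_nd.
rewrite -y0 -(telescope_sumr (fun i => F (y i)))// -(telescope_sumr y)// !big_mkord.
rewrite mulr_sumr -sumrB.
apply: le_trans (ler_norm_sum _ _ _) _; apply: ler_sum => i _.
have y_le : y i <= y i.+1 by exact: y_nd.
have [s||s] := @MVT_segment R F g (y i) (y i.+1) y_le.
- by rewrite in_itv/= => /andP[ys _]; apply: dF; rewrite (le_trans (y_ge i))// ltW.
- apply: continuous_in_subspaceT => s; rewrite inE/= in_itv/= => /andP[ys _].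
  by apply: cF; rewrite (le_trans (y_ge i)).
rewrite in_itv/= => ys ->; rewrite -mulrBl normrM.
rewrite [X in _ * X]ger0_norm ?subr_ge0// ler_wpM2r ?subr_ge0//.
exact: osc.
Qed.

Lemma riemann_sum_cvg (b : R) (y xi : nat -> nat -> R) :
  (forall n, nondecreasing_seq (y n)) -> (forall n, y n 0%N = a) ->
  y n n @[n --> \oo] --> b ->
  (forall e : R, 0 < e -> \forall n \near \oo, forall i s, (i < n)%N ->
    y n i <= s <= y n i.+1 -> `|xi n i - s| < e) ->
  \sum_(i < n) g (xi n i) * (y n i.+1 - y n i) @[n --> \oo] --> F b - F a.
Proof.
move=> y_nd y0 yb xi_tag.
have y_ge n i : a <= y n i by rewrite -(y0 n) y_nd.
have ab : a <= b by apply: (cvgr_to_ge yb); exact: nearW.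
have cFy : F (y n n) - F a @[n --> \oo] --> F b - F a.
  by apply: cvgB; [exact: (cvg_comp _ _ yb (cF ab))|exact: cvg_cst].
apply: cvg_sub0 cFy.
apply/cvgr0Pnorm_le => e e0.
have L0 : 0 < b + 1 - a by rewrite subr_gt0 ltr_pwDr.
have eL0 : 0 < e / (b + 1 - a) by rewrite divr_gt0.
have [del [del0 unif]] : exists del : R, 0 < del /\ forall s z,
    `[a, b + 1]%classic s -> `|s - z| < del -> `|g s - g z| < e / (b + 1 - a).
  near (0 : R)^'+ => del; exists del; split; near: del; first exact: nbhs_right_gt.
  by apply: compact_uniform_continuity => //; exact: segment_compact.
near=> n.
have yb1 : y n n <= b + 1.
  by near: n; apply: (cvgr_le b) => //; rewrite ltrDl.
apply: (@le_trans _ _ (e / (b + 1 - a) * (y n n - a))); last first.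
  by rewrite mulrAC ler_pdivrMr// ler_pM2l// lerD2r.
apply: riemann_sum_error_le => // i s i_n ys; rewrite distrC ltW// unif//.
  have [ys1 ys2] := andP ys; rewrite /= in_itv/= (le_trans (y_ge n i))//=.
  by rewrite (le_trans ys2)// (le_trans _ yb1)// y_nd.
rewrite distrC; move: i s i_n ys; near: n; exact: xi_tag.
Unshelve. all: by end_near. Qed.

End riemann_sums.

End real_analysis.

Section grid_sums.
Context {R : realType}.
Implicit Types (x y : nat -> nat -> R) (g F : R -> R).

Lemma close_to_grid_id : uniformly_close_to_grid (fun n i => i%:R / n%:R : R).
Proof. by move=> e e0; apply: nearW => n i _; rewrite subrr normr0. Qed.

Lemma close_to_grid_last_cvg x : uniformly_close_to_grid x ->
  x n n @[n --> \oo] --> (1 : R).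
Proof.
move=> x_grid; apply/cvgrPdist_lt => e e0; near=> n.
have n0 : n%:R != 0 :> R by rewrite pnatr_eq0 -lt0n; near: n; exists 1%N.
have close : forall i, (i <= n)%N -> `|x n i - i%:R / n%:R| < e.
  by near: n; exact: x_grid.
by rewrite distrC -[X in _ - X](divff n0) close.
Unshelve. all: by end_near. Qed.

Lemma close_to_grid_cell x y (e : R) :
  uniformly_close_to_grid x -> uniformly_close_to_grid y -> 0 < e ->
  \forall n \near \oo, forall i s, (i < n)%N -> y n i <= s <= y n i.+1 ->
    `|x n i - s| < e /\ `|x n i.+1 - s| < e.
Proof.
move=> x_grid y_grid e0; have e3 : 0 < e / 3 by rewrite divr_gt0.
near=> n => i s i_n /andP[ys sy].
have [xn yn] : (forall i, (i <= n)%N -> `|x n i - i%:R / n%:R| < e / 3) /\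
    (forall i, (i <= n)%N -> `|y n i - i%:R / n%:R| < e / 3).
  by split; near: n; [exact: x_grid|exact: y_grid].
have n_inv : n%:R^-1 < e / 3.
  rewrite invf_plt ?posrE// ?ltr0n ?(leq_ltn_trans _ i_n)//.
  near: n; exact: nbhs_infty_gtr.
have := xn _ i_n; have := yn _ i_n; have := xn _ (ltnW i_n); have := yn _ (ltnW i_n).
have n_inv0 : 0 <= n%:R^-1 :> R by rewrite invr_ge0.
rewrite -[i.+1%:R]natr1 mulrDl mul1r.
set u := i%:R / n%:R; set v := n%:R^-1 in n_inv n_inv0 *.
by rewrite !ltr_norml; split; lra.
Unshelve. all: by end_near. Qed.

Lemma grid_riemann_sum_cvg g F x : continuous g ->
  (forall s : R, 0 <= s -> is_derive s 1 F (g s)) ->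
  uniformly_close_to_grid x -> (forall n, x n 0%N = 0) ->
  (forall n, nondecreasing_seq (x n)) ->
  \sum_(i < n) g (x n i) * (x n i.+1 - x n i) @[n --> \oo] --> F 1 - F 0.
Proof.
move=> cg dF x_grid x0 x_nd; apply: riemann_sum_cvg => //.
  exact: close_to_grid_last_cvg.
move=> e e0; apply: filterS (close_to_grid_cell x_grid x_grid e0) => n cell i s i_n.
by move=> /(cell i s i_n)[].
Qed.

Lemma grid_mean_cvg g F x : continuous g ->
  (forall s : R, 0 <= s -> is_derive s 1 F (g s)) -> uniformly_close_to_grid x ->
  n%:R^-1 * \sum_(1 <= i < n.+1) g (x n i) @[n --> \oo] --> F 1 - F 0.
Proof.
move=> cg dF x_grid; pose grid n i : R := i%:R / n%:R.
have : \sum_(i < n) g (x n i.+1) * (grid n i.+1 - grid n i) @[n --> \oo] --> F 1 - F 0.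
  apply: (riemann_sum_cvg cg dF (y := grid) (xi := fun n i => x n i.+1)) => //.
  - by move=> n i j ij; rewrite ler_wpM2r ?invr_ge0 ?ler_nat.
  - by move=> n; rewrite /grid mul0r.
  - exact/close_to_grid_last_cvg/close_to_grid_id.
  move=> e e0; have := close_to_grid_cell x_grid close_to_grid_id e0.
  by apply: filterS => n cell i s i_n /(cell i s i_n)[].
apply: cvg_trans; apply: near_eq_cvg; apply: nearW => n.
rewrite big_add1 big_mkord mulr_sumr; apply: eq_bigr => i _.
by rewrite /grid -mulrBl -natr1 addrAC subrr add0r mul1r mulrC.
Qed.

Lemma grid_mean_square_cvg x : uniformly_close_to_grid x ->
  n%:R^-1 * \sum_(1 <= i < n.+1) x n i ^+ 2 @[n --> \oo] --> (3^-1 : R).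
Proof.
move=> x_grid; pose F (s : R) := s ^+ 3 / 3.
have -> : 3^-1 = F 1 - F 0 :> R by rewrite /F expr1n expr0n mul0r subr0 div1r.
apply: (@grid_mean_cvg (fun s => s ^+ 2)) => //; first exact: exprn_continuous.
move=> s _; rewrite (_ : F = 3^-1 *: (@id R) ^+ 3); last first.
  by apply/funext => z; rewrite /F mulrC.
by apply: is_derive_eq; rewrite /GRing.scale/= mulr1 mulKf ?pnatr_eq0.
Qed.

Lemma abel_summation (f : R -> R) (x : nat -> R) (c : R) (n : nat) : x 0%N = 0 ->
  \sum_(1 <= i < n.+1) (f (x i) - f (x i.-1)) * x i =
  (f (x n) - c) * x n + \sum_(i < n) (c - f (x i)) * (x i.+1 - x i).
Proof.
move=> x0; elim: n => [|n IH]; first by rewrite big_nil big_ord0 x0 mulr0 addr0.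
by rewrite big_nat_recr//= IH big_ord_recr/=; ring.
Qed.

Lemma grid_increment_sum_cvg (f : R -> R) x :
  {within `[0, +oo[, continuous f} ->
  uniformly_close_to_grid x -> (forall n, x n 0%N = 0) ->
  (forall n, nondecreasing_seq (x n)) ->
  \sum_(1 <= i < n.+1) (f (x n i) - f (x n i.-1)) * x n i @[n --> \oo] -->
  \int[lebesgue_measure]_(s in `[0, 1]) (f 1 - f s).
Proof.
(* h extends f to a continuous function on R without changing it at the nodes. *)
move=> cf x_grid x0 x_nd; pose h s := f (Num.max s 0); pose g s := h 1 - h s.
have ch : continuous h := within_itvcy_continuous_max cf.
have cg : continuous g.
  by move=> s; apply: cvgB; [exact: cvg_cst|exact: ch].
have hE s : 0 <= s -> h s = f s by move=> s0; rewrite /h max_l.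
have x_ge0 n i : 0 <= x n i by rewrite -(x0 n) x_nd.
have -> : \int[lebesgue_measure]_(s in `[0, 1]) (f 1 - f s) =
    \int[lebesgue_measure]_(s in `[0, 1]) g s.
  by apply: eq_Rintegral => s; rewrite inE/= in_itv/= => /andP[s0 _]; rewrite /g !hE.
rewrite (@Rintegral_itv_sub _ g (-1)) ?lerN10//.
have -> : (fun n => \sum_(1 <= i < n.+1) (f (x n i) - f (x n i.-1)) * x n i) =
    (fun n => (h (x n n) - h 1) * x n n + \sum_(i < n) g (x n i) * (x n i.+1 - x n i)).
  apply/funext => n; rewrite /g -abel_summation//.
  by apply: eq_bigr => i _; rewrite !hE.
rewrite -[X in _ --> X]add0r; apply: cvgD; last first.
  pose F z := \int[lebesgue_measure]_(s in `[-1, z]) g s.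
  apply: (grid_riemann_sum_cvg (F := F) cg) => // s s0.
  by apply: is_derive_Rintegral; rewrite // (lt_le_trans _ s0) ?ltrN10.
have x1 := close_to_grid_last_cvg x_grid.
rewrite -(mul0r 1) -(subrr (h 1)); apply: cvgM => //.
by apply: cvgB; [exact: (cvg_comp _ _ x1 (ch 1))|exact: cvg_cst].
Qed.

End grid_sums.

Section estimator.
Context {T : Type} {R : realType}.
Variables (a : R) (W : R -> T -> R) (w : T).

Lemma ahat_errorE (t : nat -> T -> R) (n : nat) : (0 < n)%N -> (forall j, 0 < t j w) ->
  ahat a W t n w - a =
  (\sum_(1 <= i < n.+1) (W (tau t i w) w - W (tau t i.-1 w) w) * tau t i w) /
  (\sum_(1 <= i < n.+1) tau t i w ^+ 2).
Proof.
move=> n0 t0; rewrite /ahat; set Q := \sum_(1 <= i < n.+1) tau t i w ^+ 2.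
have Q0 : Q != 0.
  rewrite gt_eqF// /Q big_ltn// ltr_wpDr//.
    by apply: sumr_ge0 => i _; exact: sqr_ge0.
  by rewrite exprn_gt0// /tau big_ord1.
rewrite -[X in _ - X](mulfK Q0) -mulrBl; congr (_ / _).
by rewrite /Q mulr_sumr -sumrB; apply: eq_bigr => i _; rewrite /Yobs; ring.
Qed.

Lemma ahat_cvg_pathwise (t : nat -> nat -> T -> R) :
  (forall n j, 0 < t n j w) ->
  {within `[0, +oo[, continuous (fun s => W s w)} ->
  uniformly_close_to_grid (fun n i => tau (t n) i w) ->
  n%:R * (ahat a W (t n) n w - a) @[n --> \oo] -->
    3 * (\int[lebesgue_measure]_(s in `[0, 1]) (W 1 w - W s w)).
Proof.
move=> t0 cW tau_grid.
have tau0 n : tau (t n) 0 w = 0 by rewrite /tau big_ord0.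
have tau_nd n : nondecreasing_seq (fun i => tau (t n) i w).
  by apply/nondecreasing_seqP => i; rewrite /tau big_ord_recr/= lerDl ltW.
have n3 : 3^-1 != 0 :> R by rewrite invr_eq0.
rewrite -[X in X * _]invrK.
apply: cvg_trans (cvgM (cvgV n3 (grid_mean_square_cvg tau_grid))
  (grid_increment_sum_cvg cW tau_grid tau0 tau_nd)).
apply: near_eq_cvg; near=> n.
rewrite ahat_errorE//; last by near: n; exists 1%N.
by rewrite /= invfM invrK -mulrA; congr (_ * _); rewrite mulrC.
Unshelve. all: by end_near. Qed.

End estimator.

Unset Implicit Arguments.

Theorem theorem2p2 (d : measure_display) (T : measurableType d) (R : realType)
  (P : probability T R) (t : nat -> nat -> T -> R) (r Ct : R)
  (W : R -> T -> R) (a : R) :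
  (forall N j, measurable_fun setT (t N j)) ->
  (forall N j w, 0 < t N j w) ->
  (forall N j, (0 < N)%N -> ('E_P[t N j] = (N%:R^-1)%:E)%E) ->
  0 < r -> 0 < Ct ->
  (forall N j, (0 < N)%N ->
     ('E_P[fun w => (t N j w `^ (2 + r))%R] <= (Ct / N%:R `^ (2 + r))%R%:E)%E) ->
  (forall N m, (0 < N)%N -> NSD P (fun i : 'I_m => t N i)) ->
  (forall s, measurable_fun setT (W s)) ->
  {ae P, forall w, {within `[0, +oo[, continuous (fun s => W s w)}} ->
  {ae P, forall w,
     (fun N : nat => N%:R * (ahat a W (t N) N w - a)) @ \oo -->
       3 * (\int[lebesgue_measure]_(s in `[0, 1]) (W 1 w - W s w))}.
Proof.
move=> mt t_gt0 Et r_gt0 Ct_gt0 Etp nsd _ cW.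
pose X N j : {RV P >-> R} := mfun_Sub (mem_set (mt N j)).
have tau_grid : {ae P, forall w, uniformly_close_to_grid (fun N i => tau (t N) i w)}.
  exact: (NSD_close_to_grid_ae (X := X) (fun N j w => ltW (t_gt0 N j w))
    Et r_gt0 (ltW Ct_gt0) Etp nsd).
apply: filterS2 cW tau_grid => w cWw tau_grid_w.
exact: ahat_cvg_pathwise.
Qed.
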